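(* Let $B_\mu=\tilde B\cap S_\mu$, where $\tilde B\subset E$ is closed, convex in $E$ and satisfies $$kw\in\tilde B,\qquad\forall k\in(0,1),\ \forall w\in\tilde B .$$ Let $u\in B_\mu$ and let $V(u)\in T_uS_\mu$. If $V(u)$ has the form $V(u)=G(u)-u$ with $G(u)\in\tilde B$, then $$\lim_{s\searrow0}s^{-1}\operatorname{dist}(u+sV(u),B_\mu)=0 .$$
   Context: $(E,\langle\cdot,\cdot\rangle)$ and $(H,(\cdot,\cdot))$ are two infinite-dimensional real Hilbert spaces with $E\hookrightarrow H\hookrightarrow E'$ with continuous injections; the injection $E\hookrightarrow H$ has norm at most $1$ and $E$ is identified with its image in $H$. For $u\in E$, $\|u\|^2=\langle u,u\rangle$ and $|u|^2=(u,u)$. For $\mu\in(0,\infty)$, $S_\mu=\{u\in E:|u|^2=\mu\}$, and for $w\in S_\mu$, $T_wS_\mu=\{\phi\in E:(\phi,w)=0\}$. The distance $\operatorname{dist}$ is taken with respect to the norm $\|\cdot\|$ of $E$. *)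

(* Defs.v *)
From HB Require Import structures.
From mathcomp Require Import all_boot all_order all_algebra.
From mathcomp Require Import all_classical all_reals all_analysis.
From mathcomp Require Import lra.

Set Implicit Arguments.
Unset Strict Implicit.
Unset Printing Implicit Defensive.

Import Order.TTheory GRing.Theory Num.Theory.
Import numFieldNormedType.Exports.

Local Open Scope classical_set_scope.
Local Open Scope ring_scope.

(* A real Hilbert space is a [completeNormedModType R] together with a
   symmetric positive definite bilinear form inducing its norm. *)
Definition is_inner_product (R : realType) (E : normedModType R)
    (ip : {dot E for idfun}) : Prop :=
  forall u : E, `|u| ^+ 2 = ip u u.

Definition infinite_dimensional (R : realType) (E : lmodType R) : Prop :=
  ~ exists s : seq E, forall u : E,
      exists c : 'I_(size s) -> R, u = \sum_(i < size s) c i *: s`_i.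

(* The map H -> E', h |-> (h, .) restricted to E along iota : E -> H.  It is
   linear in h ([dual_emb_linearl]) and, as iota has norm at most 1, takes its
   values in the topological dual of E ([dual_emb_linear],
   [dual_emb_continuous]) and is continuous for the dual norm
   ([dual_emb_bounded]); only its injectivity is an additional hypothesis. *)
Definition dual_emb (R : realType) (E H : normedModType R)
    (iota : {linear E -> H}) (ipH : {dot H for idfun}) (h : H) : E -> R :=
  fun u => ipH h (iota u).

(* Continuous injections E -> H -> E', the first one of norm at most 1. *)
Record gelfand_triple (R : realType) (E H : normedModType R)
    (iota : {linear E -> H}) (ipH : {dot H for idfun}) : Prop := {
  emb_inj : injective iota ;
  emb_continuous : continuous iota ;
  emb_norm_le1 : forall u : E, `|iota u| <= `|u| ;
  dual_emb_inj : injective (dual_emb iota ipH) }.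

Definition mass_sphere (R : realType) (E H : normedModType R)
    (iota : {linear E -> H}) (ipH : {dot H for idfun}) (mu : R) : set E :=
  [set u | ipH (iota u) (iota u) = mu].

Definition tangent_space (R : realType) (E H : normedModType R)
    (iota : {linear E -> H}) (ipH : {dot H for idfun}) (w : E) : set E :=
  [set phi | ipH (iota phi) (iota w) = 0].

Section facts.
Context (R : realType).

Lemma inner_product_CS (H : normedModType R) (ip : {dot H for idfun}) :
  is_inner_product ip -> forall u v : H, `|ip u v| <= `|u| * `|v|.
Proof.
move=> hip u v.
have sym (x y : H) : ip x y = ip y x.
  by have := @hermitian_subproof _ _ _ _ ip x y; rewrite expr0 mul1r.
have [->|v0] := eqVneq v 0; first by rewrite linear0r !normr0 mulr0.
have vv0 : 0 < ip v v by apply: neq0_dnorm_gt0.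
suff : ip u v ^+ 2 <= ip u u * ip v v.
  move=> le_sq; rewrite -(@ler_pXn2r _ 2)// ?nnegrE ?mulr_ge0//.
  by rewrite real_normK ?num_real// exprMn !hip.
have : 0 <= ip (ip v v *: u - ip u v *: v) (ip v v *: u - ip u v *: v).
  by rewrite -hip sqr_ge0.
rewrite linearBl !linearBr !linearZl_LR !linearZr_LR/= (sym v u).
set a := ip u u; set b := ip u v; set c := ip v v => h.
have {}h : 0 <= c * (c * a) - b * (c * b) - (c * (b * b) - b * (b * c)) := h.
have {}h : 0 <= c * (a * c - b ^+ 2) by apply: le_trans h _; lra.
by move: h; rewrite pmulr_rge0// subr_ge0.
Qed.

Section dual_emb_facts.
Variables (E H : normedModType R).
Variables (iota : {linear E -> H}) (ipH : {dot H for idfun}).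

Lemma dual_emb_linear (h : H) : linear (dual_emb iota ipH h : E -> R^o).
Proof. by move=> a u v; rewrite /dual_emb linearP linearPr. Qed.

Lemma dual_emb_linearl (a : R) (h h' : H) (u : E) :
  dual_emb iota ipH (a *: h + h') u
  = a * dual_emb iota ipH h u + dual_emb iota ipH h' u.
Proof. by rewrite /dual_emb linearPl. Qed.

Hypothesis ipHP : is_inner_product ipH.
Hypothesis iota1 : forall u : E, `|iota u| <= `|u|.

Lemma dual_emb_bounded (h : H) (u : E) :
  `|dual_emb iota ipH h u| <= `|h| * `|u|.
Proof.
by apply: le_trans (inner_product_CS ipHP _ _) _; exact: ler_wpM2l.
Qed.

Lemma dual_emb_continuous (h : H) : continuous (dual_emb iota ipH h).
Proof.
move=> u; apply/cvgrPdist_lt => e e0; near=> v.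
rewrite /dual_emb -linearBr -linearB.
apply: le_lt_trans (dual_emb_bounded h (u - v)) _.
apply: (@le_lt_trans _ _ ((`|h| + 1) * `|u - v|)).
  by rewrite ler_wpM2r// lerDl.
rewrite mulrC -ltr_pdivlMr ?ltr_wpDl//.
near: v; apply: (@cvgr_dist_lt _ _ _ _ _ id u cvg_id).
by rewrite divr_gt0// ltr_wpDl.
Unshelve. all: by end_near. Qed.
End dual_emb_facts.

(* On a normed space the extended distance underlying [edist_inf] is the one
   given by the norm. *)
Lemma edist_norm (E : normedModType R) (x y : E) :
  edist (x, y) = (`|x - y|)%:E.
Proof.
apply/eqP; rewrite eq_le; apply/andP; split.
  apply/lee_addgt0Pr => e e0; rewrite -EFinD; apply: edist_fin.
    by rewrite ltr_wpDl.
  by rewrite -ball_normE /ball_/= ltrDl.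
apply: le_ereal_inf_tmp => _ [r [r0]] + <-.
by rewrite -ball_normE /ball_/= lee_fin => /ltW.
Qed.

End facts.

(* Main.v *)
(* Since V u is orthogonal to u in H, w = u + s V u has |w|^2 = mu + s^2 |V u|^2,
   while w is a convex combination of u and G u.  Rescaling w onto the sphere is
   therefore a contraction by a factor 1 - O(s^2), which stays in Bt and moves w
   by O(s^2). *)

Require Import Defs.
From HB Require Import structures.
From mathcomp Require Import all_boot all_order all_algebra.
From mathcomp Require Import all_classical all_reals all_analysis.
From mathcomp Require Import ring lra.

Set Implicit Arguments.
Unset Strict Implicit.
Unset Printing Implicit Defensive.

Import Order.TTheory GRing.Theory Num.Theory.
Import numFieldNormedType.Exports.

Local Open Scope classical_set_scope.
Local Open Scope ring_scope.

Lemma edist_inf_le (R : realType) (E : normedModType R) (A : set E) (x y : E) :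
  A y -> (edist_inf A x <= `|x - y|%:E)%E.
Proof. by move=> Ay; rewrite -edist_norm; apply: ereal_inf_lbound; exists y. Qed.

Lemma convex_set_segment (R : realType) (E : lmodType R) (A : set E)
    (x y : E) (s : R) :
  convex_set A -> 0 <= s -> s <= 1 -> A x -> A y -> A (x + s *: (y - x)).
Proof.
move=> cA s0 s1 Ax Ay.
(* [convex_set] puts the weight [s] on its first point and [1 - s] on the second, hence [y] before
   [x]. *)
have /set_mem := cA y x (Itv01 s0 s1) (mem_set Ay) (mem_set Ax).
congr (A _).
change (s *: y + (1 - s) *: x = x + s *: (y - x)).
by rewrite scalerBl scale1r scalerBr addrCA addrA.
Qed.

Lemma dot_scale (R : realType) (H : normedModType R)
    (ip : {dot H for idfun}) (k : R) (x : H) :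
  ip (k *: x) (k *: x) = k ^+ 2 * ip x x.
Proof. by rewrite linearZl_LR linearZr_LR/= expr2 mulrA. Qed.

Lemma dot_pythagoras (R : realType) (H : normedModType R)
    (ip : {dot H for idfun}) (x y : H) :
  ip y x = 0 -> ip (x + y) (x + y) = ip x x + ip y y.
Proof.
move=> yx0; have xy0 : ip x y = 0.
  by have := @hermitian_subproof _ _ _ _ ip x y; rewrite expr0 mul1r => ->.
by rewrite linearDl !linearDr/= yx0 xy0 addr0 add0r.
Qed.

Lemma sqrt_div_le1 (R : realType) (mu q : R) :
  0 < mu -> 0 <= q -> Num.sqrt (mu / (mu + q)) <= 1.
Proof.
move=> mu0 q0; rewrite -sqrtr1; apply: ler_wsqrtr.
by rewrite ler_pdivrMr ?mul1r ?lerDl// ltr_wpDr.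
Qed.

(** A number [k] in [0, 1] satisfies [k ^+ 2 <= k], so [1 - k] is at most [1 - k ^+ 2], which is
    rational in [mu] and [q]. The bound is linear in [q]; with [q] of order s^2 this gives the
    quadratic smallness of the rescaling. *)
Lemma subr1_sqrt_div_le (R : realType) (mu q : R) :
  0 < mu -> 0 <= q -> 1 - Num.sqrt (mu / (mu + q)) <= q / mu.
Proof.
move=> mu0 q0; have mq0 : 0 < mu + q by rewrite ltr_wpDr.
set k := Num.sqrt _.
have k0 : 0 <= k by exact: sqrtr_ge0.
have k2 : k ^+ 2 = mu / (mu + q) by rewrite sqr_sqrtr// divr_ge0// ltW.
have k1 : k <= 1 by exact: sqrt_div_le1.
have : 1 - k <= 1 - k ^+ 2 by nra.
move=> /le_trans; apply; rewrite k2.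
have -> : 1 - mu / (mu + q) = q / (mu + q) by field; rewrite gt_eqF.
by rewrite ler_wpM2l// lef_pV2 ?posrE// lerDl.
Qed.

(** The radial projection of [u + v] onto the sphere is a competitor for the distance. The bound is
    quadratic in [v], so taking [v := s *: V u] leaves a factor s after division by s. *)
Lemma edist_inf_sphere_le (R : realType) (E H : normedModType R)
    (iota : {linear E -> H}) (ipH : {dot H for idfun})
    (ipH_hilbert : is_inner_product ipH) (mu : R) (mu_gt0 : 0 < mu)
    (Bt : set E)
    (Bt_scale : forall (k : R) (w : E), 0 < k < 1 -> Bt w -> Bt (k *: w))
    (u v : E) :
  mass_sphere iota ipH mu u -> tangent_space iota ipH u v -> Bt (u + v) ->
  (edist_inf (Bt `&` mass_sphere iota ipH mu) (u + v)%R
     <= (`|iota v| ^+ 2 / mu * `|u + v|)%R%:E)%E.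
Proof.
move=> Su Tv Bw; set w := u + v; set q := `|iota v| ^+ 2.
have q0 : 0 <= q by rewrite exprn_ge0.
have mq0 : 0 < mu + q by rewrite ltr_wpDr.
have ww : ipH (iota w) (iota w) = mu + q.
  by rewrite /w linearD dot_pythagoras// Su /q ipH_hilbert.
(* The positive factor for which [k ^+ 2 * (mu + q) = mu], so that [k *: w] has mass [mu]. *)
pose k := Num.sqrt (mu / (mu + q)).
have k2 : k ^+ 2 = mu / (mu + q) by rewrite sqr_sqrtr// divr_ge0// ltW.
have k0 : 0 < k by rewrite sqrtr_gt0 divr_gt0.
have k1 : k <= 1 by exact: sqrt_div_le1.
have Bkw : (Bt `&` mass_sphere iota ipH mu) (k *: w).
  split.
    (* [Bt_scale] covers only factors below 1; when [k = 1] the point is [w] itself. *)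
    move: k1; rewrite le_eqVlt => /predU1P[->|k1]; first by rewrite scale1r.
    by apply: Bt_scale; rewrite ?k0.
  by rewrite /mass_sphere/= linearZ dot_scale ww k2 divfK// gt_eqF.
apply: le_trans (edist_inf_le w Bkw) _; rewrite lee_fin.
rewrite -{1}[w]scale1r -scalerBl normrZ ger0_norm ?subr_ge0//.
by apply: ler_wpM2r => //; exact: subr1_sqrt_div_le.
Qed.

Theorem lemma4p7 (R : realType) (E H : completeNormedModType R)
    (ipE : {dot E for idfun}) (ipH : {dot H for idfun})
    (iota : {linear E -> H})
    (ipE_hilbert : is_inner_product ipE)
    (ipH_hilbert : is_inner_product ipH)
    (E_infinite : infinite_dimensional E)
    (H_infinite : infinite_dimensional H)
    (EHE' : gelfand_triple iota ipH)
    (mu : R) (mu_gt0 : 0 < mu)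
    (Bt : set E)
    (Bt_closed : closed Bt)
    (Bt_convex : convex_set Bt)
    (Bt_scale : forall (k : R) (w : E), 0 < k < 1 -> Bt w -> Bt (k *: w))
    (u : E)
    (u_in : (Bt `&` mass_sphere iota ipH mu) u)
    (V G : E -> E)
    (V_tangent : tangent_space iota ipH u (V u))
    (V_form : V u = G u - u)
    (G_in : Bt (G u)) :
  ((s^-1)%:E * edist_inf (Bt `&` mass_sphere iota ipH mu) (u + s *: V u)%R)%E
    @[s --> 0^'+] --> 0%E.
Proof.
have [Bu Su] := u_in.
(* For [s <= 1] the norm of [u + s *: V u] is at most the last factor, uniformly in [s]; the
   quotient is then squeezed between 0 and [s * C]. *)
pose C := `|iota (V u)| ^+ 2 / mu * (`|u| + `|V u|).
apply: (@squeeze_cvge _ _ _ _ (cst 0%E) _ (fun s : R => (s * C)%:E)).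
- near=> s.
  have s0 : 0 < s by near: s; exact: nbhs_right_gt.
  have s1 : s <= 1 by near: s; exact: nbhs_right_ltW.
  apply/andP; split.
    by rewrite mule_ge0 ?edist_inf_ge0// lee_fin invr_ge0 ltW.
  rewrite muleC lee_pdivrMr// -EFinM.
  have Tsv : tangent_space iota ipH u (s *: V u).
    by rewrite /tangent_space/= linearZ linearZl_LR/= V_tangent mulr0.
  have Bw : Bt (u + s *: V u).
    (* With [V u = G u - u], this is a point of the segment from [u] to [G u]. *)
    by rewrite V_form; apply: convex_set_segment => //; exact: ltW.
  apply: le_trans (edist_inf_sphere_le ipH_hilbert mu_gt0 Bt_scale Su Tsv Bw) _.
  rewrite lee_fin linearZ normrZ exprMn gtr0_norm//.
  (* The right-hand side is [s * C * s], the second [s] coming from clearing [s^-1]; regrouped, it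
     differs from the left only in the last factor. *)
  rewrite [leRHS](_ : _ = s ^+ 2 * `|iota (V u)| ^+ 2 / mu * (`|u| + `|V u|)).
    apply: ler_wpM2l.
      by rewrite divr_ge0 ?mulr_ge0 ?exprn_ge0// ltW.
    apply: le_trans (ler_normD _ _) _; rewrite lerD2l normrZ gtr0_norm//.
    by rewrite ler_piMl.
  by rewrite /C; ring.
- exact: cvg_cst.
- apply: cvg_EFin; first exact: nearW.
  apply: cvg_at_right_filter.
  rewrite -[X in _ --> X](mul0r C); apply: cvgMl; exact: cvg_id.
Unshelve. all: by end_near. Qed.
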